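(* Let $\mathcal X,\mathcal Y$ be Polish spaces, $\mathbb P\in\mathcal P(\mathcal X)$, $\varepsilon\ge 0$, let $f:\mathcal X\to\mathcal Y$ be an arbitrary (Borel) map, and let $d:\mathcal Y\times\mathcal Y\to\mathbb R_{\ge 0}$ be a transportation cost on $\mathcal Y$. Then $$f_{\#}\,\mathbb B_\varepsilon^{d\circ(f\times f)}(\mathbb P)\subset \mathbb B_\varepsilon^{d}(f_{\#}\mathbb P).$$ Moreover, let $c:\mathcal X\times\mathcal X\to\mathbb R_{\ge 0}$ be a transportation cost on $\mathcal X$. Then: 1) If $f$ is bijective, with inverse $f^{-1}$, then $$f_{\#}\,\mathbb B_\varepsilon^{c}(\mathbb P)=\mathbb B_\varepsilon^{c\circ(f^{-1}\times f^{-1})}(f_{\#}\mathbb P).$$ 2) If $f$ is injective, with (Borel) left inverse $f^{-1}:\mathcal Y\to\mathcal X$ (i.e. $f^{-1}\circ f=\mathrm{Id}_{\mathcal X}$), then $$f_{\#}\,\mathbb B_\varepsilon^{c}(\mathbb P)=(f\circ f^{-1})_{\#}\,\mathbb B_\varepsilon^{c\circ(f^{-1}\times f^{-1})}(f_{\#}\mathbb P)\subset \mathbb B_\varepsilon^{c\circ(f^{-1}\times f^{-1})}(f_{\#}\mathbb P).$$ 3) If $f$ is surjective, with (Borel) right inverse $f^{-1}:\mathcal Y\to\mathcal X$ (i.e. $f\circ f^{-1}=\mathrm{Id}_{\mathcal Y}$), then $$f_{\#}\,\mathbb B_\varepsilon^{c\circ(f^{-1}\times f^{-1})\circ(f\times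 f)}(\mathbb P)=\mathbb B_\varepsilon^{c\circ(f^{-1}\times f^{-1})}(f_{\#}\mathbb P)\subset f_{\#}\,\mathbb B_\varepsilon^{c}\big((f^{-1}\circ f)_{\#}\mathbb P\big).$$
   Context: $\mathcal P(\mathcal X)$ is the set of Borel probability distributions on $\mathcal X$. All maps are assumed Borel. For $f:\mathcal X\to\mathcal Y$, the pushforward is $(f_{\#}\mathbb P)(\mathcal A)=\mathbb P(f^{-1}(\mathcal A))$ for Borel $\mathcal A\subset\mathcal Y$; for a set $S\subset\mathcal P(\mathcal X)$, $f_{\#}S=\{f_{\#}\mathbb Q:\mathbb Q\in S\}$. The map $f\times f$ sends $(x_1,x_2)$ to $(f(x_1),f(x_2))$. A transportation cost on $\mathcal X$ is a non-negative lower semi-continuous function $c:\mathcal X\times\mathcal X\to\mathbb R_{\ge0}$. The optimal transport (OT) discrepancy is $$W_c(\mathbb P,\mathbb Q)=\inf_{\gamma\in\Gamma(\mathbb P,\mathbb Q)}\int_{\mathcal X\times\mathcal X}c(x_1,x_2)\,d\gamma(x_1,x_2),$$ where $\Gamma(\mathbb P,\mathbb Q)$ is the set of probability distributions on $\mathcal X\times\mathcal X$ with marginals $\mathbb P$ and $\mathbb Q$. The OT ambiguity set of radius $\varepsilon$ centered at $\mathbb P$ is $\mathbb B_\varepsilon^c(\mathbb P)=\{\mathbb Q\in\mathcal P(\mathcal X):W_c(\mathbb P,\mathbb Q)\le\varepsilon\}$. The same formulas define $W$ and $\mathbb B$ for the composed (Borel, non-negative) costs such as $d\circ(f\times f)$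 on $\mathcal X$ and $c\circ(f^{-1}\times f^{-1})$ on $\mathcal Y$. *)

(* Defs.v *)
From HB Require Import structures.
From mathcomp Require Import all_boot all_order all_algebra.
From mathcomp Require Import all_classical all_reals all_analysis.

Set Implicit Arguments.
Unset Strict Implicit.
Unset Printing Implicit Defensive.

Import Order.TTheory GRing.Theory Num.Theory.
Import numFieldNormedType.Exports.

Local Open Scope classical_set_scope.
Local Open Scope ring_scope.

Definition is_metric (R : realType) (T : Type) (dist : T -> T -> R) : Prop :=
  [/\ forall x y, 0 <= dist x y,
      forall x y, dist x y = 0 <-> x = y,
      forall x y, dist x y = dist y x &
      forall x y z, dist x z <= dist x y + dist y z].

Definition metrizes (R : realType) (T : topologicalType) (dist : T -> T -> R)
    : Prop :=
  forall (x : T) (A : set T),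
    nbhs x A <-> exists2 e : R, 0 < e & [set y | dist x y < e] `<=` A.

Definition complete_metric (R : realType) (T : topologicalType)
    (dist : T -> T -> R) : Prop :=
  forall u : nat -> T,
    (forall e : R, 0 < e -> exists N : nat, forall m n : nat,
        (N <= m)%N -> (N <= n)%N -> dist (u m) (u n) < e) ->
    exists l : T, u @ \oo --> l.

(* The metric is only required to exist, it is not part of the structure. *)
Definition polish (R : realType) (T : topologicalType) : Prop :=
  (exists2 D : set T, countable D & dense D) /\
  exists dist : T -> T -> R,
    [/\ is_metric dist, metrizes dist & complete_metric dist].

Notation borel T := (g_sigma_algebraType (@open T)).

Section optimal_transport.
Variable R : realType.

Definition transportation_cost (T : topologicalType) (c : T * T -> R) : Prop :=
  (forall z, 0 <= c z) /\ lower_semicontinuous (fun z => (c z)%:E).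

Definition prod_map (A B : Type) (h : A -> B) (z : A * A) : B * B :=
  (h z.1, h z.2).

Definition coupling (T : ptopologicalType) (P Q : probability (borel T) R)
    : set (probability (borel (T * T)%type) R) :=
  [set gamma | forall A : set (borel T), measurable A ->
     gamma [set z | A z.1] = P A /\ gamma [set z | A z.2] = Q A].

Definition OT (T : ptopologicalType) (c : T * T -> R)
    (P Q : probability (borel T) R) : \bar R :=
  ereal_inf [set (\int[gamma]_(z in [set: borel (T * T)%type]) (c z)%:E)%E
            | gamma in coupling P Q].

Definition OT_ball (T : ptopologicalType) (c : T * T -> R) (eps : R)
    (P : probability (borel T) R) : set (probability (borel T) R) :=
  [set Q | (OT c P Q <= eps%:E)%E].

(* [distribution Q f] is the pushforward of Q by f. An inhabitant of
   [probability] is a function on all sets, whose values on non-measurable sets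
   are irrelevant; the image is therefore closed under equality on Borel sets. *)
Definition pushforward_set (X Y : ptopologicalType)
    (f : {mfun borel X >-> borel Y}) (S : set (probability (borel X) R))
    : set (probability (borel Y) R) :=
  [set Q' | exists2 Q, S Q & forall A : set (borel Y), measurable A ->
     Q' A = distribution Q f A].

End optimal_transport.

(* Main.v *)
Require Import Defs.
From HB Require Import structures.
From mathcomp Require Import all_boot all_order all_algebra.
From mathcomp Require Import all_classical all_reals all_analysis.
From mathcomp Require Import measurable_realfun lra.

Set Implicit Arguments.
Unset Strict Implicit.
Unset Printing Implicit Defensive.

Import Order.TTheory GRing.Theory Num.Theory.
Import numFieldNormedType.Exports.

Local Open Scope classical_set_scope.
Local Open Scope ring_scope.

(** Everything except one inclusion is a change of variables. If f pushes P
to P' and Q to Q', then f x f pushes every coupling of P and Q to a coupling of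
P' and Q', and the cost e of the image is the cost e \o (f x f) of the source
([OT_pushforward_le]); hence OT e P' Q' <= OT (e \o (f x f)) P Q. Applied to f
and to its one-sided inverse g, with (c \o (g x g)) \o (f x f) = c when
g \o f = id, this gives the first inclusion, parts 1 and 2, and the last
inclusion of part 3.

The remaining inclusion, in part 3, asks for the opposite inequality when f is
surjective with right inverse g: a coupling gamma of f_# P and Q has to be
lifted to a coupling of P and g_# Q with image gamma under f x f
([OT_lift_le]). The second coordinate lifts by g, but the first has to be lifted
to the prescribed law P, so the lift is a gluing of P and gamma over f. The
gluing is obtained from an external uniform variable: there is a measurable h
such that, for x of law P and u uniform on [0, 1] and independent of x, the pair
(f x, h (x, u)) has law gamma ([transfer]).

For a real-valued second coordinate, h is the inverse of the conditional
distribution function. The conditional probabilities G_E of the events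
E = (q <= r), r rational, given the first coordinate, are Radon-Nikodym
densities ([conditional_density]); they are monotone in E only up to null sets,
and h (x, u) is the infimum of the rationals r with u < G_(q <= r) (f x).

A Polish space is a Borel retract of the real line ([polish_real_coding]): a
point is coded by the digits saying which balls around a dense sequence contain
it, the digits are packed in a real number by the Cantor expansion, and the
point is recovered as a limit of centers.

Finally f x f is Borel and a law on Y x Y is determined by its values on
rectangles because the Borel sets of Y x Y are generated by rectangles; here
a countable base is needed. *)

(** * Conditional probabilities *)

Section densities.
Local Open Scope ereal_scope.
Context d2 (Y : measurableType d2) (R : realType).

(** The Radon-Nikodym density g of m is at most 1 almost everywhere: on the set
where g > 1, the integrals of g and of 1 agree on every measurable subset. So
truncating g at 1 changes no integral, and makes the bound hold everywhere. *)
Lemma density_in01 (nu : probability Y R) (m : {measure set Y -> \bar R}) :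
  (forall A, measurable A -> m A <= nu A) ->
  exists G : Y -> R, [/\ measurable_fun setT G,
    forall y, (0 <= G y <= 1)%R &
    forall A, measurable A -> \int[nu]_(y in A) (G y)%:E = m A].
Proof.
move=> m_le.
have mToo : m setT < +oo.
  by apply: le_lt_trans (m_le _ measurableT) _; rewrite probability_setT ltry.
(* m with the structure of a finite measure *)
pose m_fm := mfrestr measurableT mToo.
have m_fmE A : m_fm A = m A by rewrite /m_fm /mfrestr /mrestr setIT.
have m_nu : m_fm `<< nu.
  apply/null_content_dominatesP => A mA nuA0.
  by apply/eqP; rewrite m_fmE -measure_le0 -nuA0; exact: m_le.
have [g [g0 gfin gint gE_fm]] := radon_nikodym_sigma_finite m_nu.
have gE A : measurable A -> m A = \int[nu]_(y in A) g y.
  by move=> mA; rewrite -m_fmE; exact: gE_fm.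
have mg : measurable_fun setT g by exact: measurable_int gint.
pose N := [set y | 1 < g y].
have mN : measurable N by rewrite -[N]setTI; exact: emeasurable_fun_o_infty.
have gN1 : ae_eq nu N g (cst 1).
  apply: integral_ae_eq => //.
  - exact: integrableS gint.
  - move=> B BN mB; rewrite integral_cst// mul1e; apply/eqP.
    rewrite eq_le; apply/andP; split; first by rewrite -gE//; exact: m_le.
    rewrite -[leLHS]mul1e -integral_cst//.
    apply: ge0_le_integral => //.
    + by apply: measurable_funS mg.
    + by move=> y /BN/ltW.
have N0 : nu.-negligible N.
  apply: negligibleS gN1 => y Ny /(_ Ny) gy1.
  by move: Ny; rewrite /N /= gy1 ltxx.
pose G y := fine (mine (g y) 1).
have GE y : (G y)%:E = mine (g y) 1.
  by rewrite /G fineK// /mine; case: ifP.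
have mG : measurable_fun setT G.
  apply/measurable_EFinP; rewrite (_ : _ \o _ = fun y => mine (g y) 1).
    exact: measurable_mine.
  by apply/funext => y; exact: GE.
exists G; split => //.
  by move=> y; rewrite -!lee_fin GE le_min g0 lee01 ge_min lexx orbT.
move=> A mA; transitivity (\int[nu]_(y in A) g y); last by rewrite -gE.
apply: ge0_ae_eq_integral => //.
- by apply: measurable_funTS; exact/measurable_EFinP.
- exact: measurable_funTS.
- by move=> y _; rewrite GE le_min g0 lee01.
- apply: negligibleS N0 => y; apply: contra_notP => /negP.
  by rewrite -leNgt => gy1 _ /=; rewrite GE; apply/min_idPl.
Qed.

Context d1 d3 (X : measurableType d1) (W : measurableType d3).
Variables (P : probability X R) (gamma : probability W R)
  (f : {mfun X >-> Y}) (p : {mfun W >-> Y}).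
Hypothesis Pf_gammap : forall A, measurable A ->
  P (f @^-1` A) = gamma (p @^-1` A).

(** G \o f plays the part of the conditional probability of E given p,
transported to X, where f has the law of p. *)
Lemma conditional_density (E : set W) : measurable E ->
  exists G : Y -> R, [/\ measurable_fun setT G,
    forall y, (0 <= G y <= 1)%R &
    forall A, measurable A ->
      \int[P]_(x in f @^-1` A) (G (f x))%:E = gamma (p @^-1` A `&` E)].
Proof.
move=> mE.
unshelve epose (m := pushforward (mrestr gamma mE) p :
  {measure set Y -> \bar R}); first exact: measurable_funPT.
have m_le A : measurable A -> m A <= distribution P f A.
  move=> mA; rewrite /distribution /pushforward [leRHS]Pf_gammap//.
  by apply: measureIl => //; exact: measurable_funPTI.
have [|G [mG G01 GE]] := @density_in01 (distribution P f) m.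
  exact: m_le.
exists G; split => // A mA; rewrite -[RHS]GE// ge0_integral_pushforward//.
- by apply: measurable_funTS; exact/measurable_EFinP.
- by move=> y _; rewrite lee_fin; case/andP: (G01 y).
Qed.

End densities.

(** * Adding an independent uniform variable *)

Section fiber_uniform.
Local Open Scope ereal_scope.
Context d1 (X : measurableType d1) (R : realType).
Variable (P : probability X R).

Definition unif01 : probability (measurableTypeR R) R :=
  uniform_prob (@ltr01 R).

Lemma unif01_below (g : R) : (0 <= g <= 1)%R ->
  unif01 [set u | (u < g)%R] = g%:E.
Proof.
move=> /andP[g0 g1]; rewrite /unif01 /= /uniform_prob integral_uniform_pdf.
rewrite (_ : [set u | _] `&` _ = `[0%R, g%R[%classic); last first.
  apply/seteqP; split => u /=; rewrite !in_itv/=.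
    by case=> ug /andP[-> _].
  by move=> /andP[-> ug]; rewrite ug (le_trans (ltW ug)).
rewrite (eq_integral (cst 1)); last first.
  move=> u; rewrite inE/= in_itv/= => /andP[u0 ug].
  by rewrite /uniform_pdf u0 (le_trans (ltW ug))//= subr0 invr1.
rewrite integral_cst//= mul1e lebesgue_measure_itv/= lte_fin.
case: ltP => [_|]; first by rewrite sube0.
by move=> gle0; congr EFin; apply/eqP; rewrite eq_le g0 gle0.
Qed.

Definition with_uniform : probability (X * measurableTypeR R)%type R :=
  P \x unif01.

Lemma measurable_subgraph (G : X -> R) : measurable_fun setT G ->
  measurable [set z : X * R | (z.2 < G z.1)%R].
Proof.
move=> mG; rewrite (_ : [set z | _] =
    [set: X * R] `&` (fun z : X * R => (z.2 < G z.1)%R) @^-1` [set true]).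
  apply: measurable_fun_ltr => //; apply: measurableT_comp mG _.
  exact: measurable_fst.
by rewrite setTI.
Qed.

(** Turns conditional probabilities into events of the enlarged space: the fiber
over x of the region below the graph of G has probability G x. *)
Lemma product_subgraph (G : X -> R) (B : set X) : measurable_fun setT G ->
  (forall x, 0 <= G x <= 1)%R -> measurable B ->
  with_uniform ([set z | B z.1] `&` [set z | (z.2 < G z.1)%R]) =
  \int[P]_(x in B) (G x)%:E.
Proof.
move=> mG G01 mB; rewrite /with_uniform /product_measure1 /=.
rewrite [RHS]integral_mkcond.
apply: eq_integral => x _ /=; rewrite patchE; case: ifPn => xB.
  rewrite -unif01_below; last exact: G01.
  congr (unif01 _); apply/seteqP; split => u /=; rewrite /xsection/= inE/=.
    by case.
  by move=> uG; split => //; exact: set_mem.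
rewrite (_ : xsection _ x = set0) ?measure0//; apply/seteqP; split => u //=.
by rewrite /xsection/= inE/= => -[Bx _]; move: xB; rewrite notin_setE; exact.
Qed.

End fiber_uniform.

(** * The transfer theorem for a real coordinate *)

Section transfer.
Local Open Scope ereal_scope.
Context d1 d2 d3 (X : measurableType d1) (Y : measurableType d2)
  (W : measurableType d3) (R : realType).
Variables (P : probability X R) (gamma : probability W R)
  (f : {mfun X >-> Y}) (p : {mfun W >-> Y}) (q : {mfun W >-> R}).
Hypothesis Pf_gammap : forall A, measurable A ->
  P (f @^-1` A) = gamma (p @^-1` A).
Hypothesis q01 : forall w, (0 <= q w <= 1)%R.

Local Notation M := (with_uniform P).

Let G_ex : exists G : set W -> Y -> R, forall E, measurable E ->
  [/\ measurable_fun setT (G E), forall y, (0 <= G E y <= 1)%R &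
    forall A, measurable A ->
      \int[P]_(x in f @^-1` A) (G E (f x))%:E = gamma (p @^-1` A `&` E)].
Proof.
have /choice[G GP] : forall E : set W, exists GE : Y -> R, measurable E ->
    [/\ measurable_fun setT GE, forall y, (0 <= GE y <= 1)%R &
    forall A, measurable A ->
      \int[P]_(x in f @^-1` A) (GE (f x))%:E = gamma (p @^-1` A `&` E)].
  move=> E; have [mE|nE] := pselect (measurable E); last by exists (cst 0%R).
  by have [GE] := conditional_density Pf_gammap mE; exists GE.
by exists G.
Qed.

Let G := sval (cid G_ex).
Let GP := svalP (cid G_ex).
Let D E : set (X * measurableTypeR R) := [set z | (z.2 < G E (f z.1))%R].

Let mGf E : measurable E -> measurable_fun setT (G E \o f).
Proof. by move=> /GP[mG _ _]; exact: measurableT_comp. Qed.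

Let mD E : measurable E -> measurable (D E).
Proof. by move=> mE; exact: (measurable_subgraph (mGf mE)). Qed.

Let cyl (A : set Y) : set (X * measurableTypeR R) := [set z | A (f z.1)].

Let mcyl A : measurable A -> measurable (cyl A).
Proof.
move=> mA; rewrite /cyl -[X in measurable X]setTI.
exact: (measurableT_comp (measurable_funPT f) measurable_fst measurableT mA).
Qed.

Let M_D E A : measurable E -> measurable A ->
  M (cyl A `&` D E) = gamma (p @^-1` A `&` E).
Proof.
move=> mE mA; have [_ G01 GE] := GP mE.
rewrite -GE// -(product_subgraph P (mGf mE))//.
  by move=> x; exact: G01.
exact: measurable_funPTI.
Qed.

(* On cyl A the region of F lies below that of E, while its measure is at least
   that of E; so the part of D E outside D F, which lies over cyl A, is null. *)
Let M_D_mono E F : measurable E -> measurable F -> E `<=` F ->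
  M (D E `\` D F) = 0.
Proof.
move=> mE mF EF; pose A := [set y | (G F y < G E y)%R].
have [mGE _ _] := GP mE; have [mGF _ _] := GP mF.
have mA : measurable A.
  rewrite (_ : A = [set: Y] `&` (fun y => (G F y < G E y)%R) @^-1` [set true]).
    exact: measurable_fun_ltr.
  by rewrite setTI.
have DFE : cyl A `&` D F `<=` cyl A `&` D E.
  by move=> z [Az DFz]; split => //; exact: lt_trans DFz Az.
have mAE : measurable (cyl A `&` D E).
  by apply: measurableI; [exact: mcyl|exact: mD].
have mAF : measurable (cyl A `&` D F).
  by apply: measurableI; [exact: mcyl|exact: mD].
rewrite (_ : D E `\` D F = (cyl A `&` D E) `\` (cyl A `&` D F)); last first.
  apply/seteqP; split => z.
    move=> [DEz DFz]; split; last by case.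
    split => //; apply: le_lt_trans DEz.
    by rewrite leNgt; exact/negP.
  by move=> [[Az DEz] nADF]; split => // DFz; exact: nADF.
have ME_le : M (cyl A `&` D E) <= M (cyl A `&` D F).
  rewrite !M_D//; apply: le_measure; rewrite ?inE.
  - by apply: measurableI => //; exact: measurable_funPTI.
  - by apply: measurableI => //; exact: measurable_funPTI.
  - exact: setIS.
apply/eqP; rewrite -measure_le0 measureD//; last first.
  by rewrite ltey_eq fin_num_measure.
by rewrite (setIidr DFE) leeBlDr ?fin_num_measure// add0e.
Qed.

Let Ele (r : R) := [set w | (q w <= r)%R].
Let Elt (t : R) := [set w | (q w < t)%R].

Let mEle r : measurable (Ele r).
Proof.
rewrite (_ : Ele r = q @^-1` `]-oo, r]%classic); last first.
  by apply/seteqP; split => w; rewrite /= in_itv.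
exact: measurable_funPTI.
Qed.

Let mElt r : measurable (Elt r).
Proof.
rewrite (_ : Elt r = q @^-1` `]-oo, r[%classic); last first.
  by apply/seteqP; split => w; rewrite /= in_itv.
exact: measurable_funPTI.
Qed.

(* h is the generalized inverse of the conditional distribution function. The
   reals s >= 1 make S nonempty even when u < G fails for every rational, as it
   does for u = 1; this is harmless since q <= 1. *)
Let S z : set R := [set s | (1 <= s)%R \/
  exists r : rat, [/\ s = ratr r, (0 <= s)%R & D (Ele s) z]].
Let h z : R := inf (S z).

Let S_ge0 z s : S z s -> (0 <= s)%R.
Proof. by case=> [|[r []]//]; exact: le_trans. Qed.

Let h_lt z t : (h z < t)%R <-> exists2 s, S z s & (s < t)%R.
Proof.
have Sinf : has_inf (S z).
  by split; [exists 1%R; left|exists 0%R => s; exact: S_ge0].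
split => [ht|[s Ss st]]; last first.
  by apply: le_lt_trans st; apply: ge_inf => //; case: Sinf.
have [|s Ss] := inf_adherent (eps := (t - h z)%R) _ Sinf.
  by rewrite subr_gt0.
by rewrite -/(h z) addrC subrK => st; exists s.
Qed.

Let rat_enum : exists rs : nat -> rat, forall r, exists n, rs n = r.
Proof.
exists (fun n => odflt 0%R (unpickle n)) => r.
by exists (pickle r); rewrite pickleK.
Qed.

Let rs := sval (cid rat_enum).

Let idx (t : R) (n : nat) : set (X * measurableTypeR R) :=
  if (0 <= (ratr (rs n) : R) < t)%R then D (Ele (ratr (rs n))) else set0.

Let idxE t r : (0 <= (ratr r : R) < t)%R ->
  exists n, idx t n = D (Ele (ratr r)).
Proof.
have [n <-] := svalP (cid rat_enum) r.
by rewrite -/rs => r0t; exists n; rewrite /idx r0t.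
Qed.

Let midx t n : measurable (idx t n).
Proof. by rewrite /idx; case: ifP => // _; exact: mD. Qed.

Let h_preimage t : (t <= 1)%R -> [set z | (h z < t)%R] = \bigcup_n idx t n.
Proof.
move=> t1; apply/seteqP; split => z.
  move/h_lt => [s [s1|[r [-> r0 Dz]]] st].
    by move: (lt_le_trans st t1); rewrite ltNge s1.
  by have [|n zn] := @idxE t r; [rewrite r0 st|exists n => //; rewrite zn].
move=> [n _]; rewrite /idx; case: ifP => // /andP[r0 rt] Dz.
by apply/h_lt; exists (ratr (rs n)) => //; right; exists (rs n).
Qed.

Let h_preimage1 t : (1 < t)%R -> [set z | (h z < t)%R] = setT.
Proof.
move=> t1; apply/seteqP; split => // z _; apply/h_lt; exists 1%R => //; left.
exact: lexx.
Qed.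

Let mh : measurable_fun setT h.
Proof.
apply: (measurability _ (RGenInftyO.measurableE R)).
move=> /= _ [_ [t ->]] <-; rewrite setTI.
rewrite (_ : _ @^-1` _ = [set z | (h z < t)%R]); last first.
  by apply/seteqP; split => z; rewrite /= in_itv.
have [t1|t1] := leP t 1%R.
  by rewrite h_preimage//; exact: bigcupT_measurable.
by rewrite h_preimage1.
Qed.

Let M_h_lt A t : measurable A ->
  M (cyl A `&` [set z | (h z < t)%R]) = gamma (p @^-1` A `&` Elt t).
Proof.
move=> mA; have mpA : measurable (p @^-1` A) by exact: measurable_funPTI.
have [t1|t1] := leP t 1%R; last first.
  rewrite h_preimage1// setIT (_ : Elt t = setT) ?setIT; last first.
    apply/seteqP; split => // w _; apply: le_lt_trans t1.
    by case/andP: (q01 w).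
  rewrite -Pf_gammap//.
  rewrite (_ : cyl A = (f @^-1` A) `*` setT); last first.
    by apply/seteqP; split => z //= [].
  rewrite [LHS]product_measure1E//; last exact: measurable_funPTI.
  by rewrite [X in _ * X](probability_setT (@unif01 R)) mule1.
rewrite h_preimage//.
apply/eqP; rewrite eq_le; apply/andP; split.
  (* each D (Ele r) with r < t is contained in D (Elt t) up to a null set *)
  pose N := \bigcup_n (idx t n `\` D (Elt t)).
  have mN : measurable N.
    by apply: bigcupT_measurable => n; apply: measurableD => //; exact: mD.
  have N0 : M N = 0.
    apply/negligibleP => //; apply: negligible_bigcup => n.
    apply/negligibleP; first by apply: measurableD => //; exact: mD.
    rewrite /idx; case: ifPn => [/andP[_ rt]|_]; last by rewrite set0D measure0.
    by apply: M_D_mono => // w; rewrite /Ele/Elt/= => qr; exact: le_lt_trans rt.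
  rewrite -(M_D (mElt t) mA).
  have mI : measurable (cyl A `&` D (Elt t)).
    by apply: measurableI; [exact: mcyl|exact: mD].
  rewrite -(measureU0 mI mN N0); apply: le_measure; rewrite ?inE.
  - by apply: measurableI; [exact: mcyl|exact: bigcupT_measurable].
  - exact: measurableU.
  - move=> z [Az [n _ zn]]; have [Dz|nDz] := pselect (D (Elt t) z).
      by left.
    by right; exists n.
have [t0|t0] := leP t 0%R.
  rewrite (_ : Elt t = set0) ?setI0 ?measure0//.
  apply/seteqP; split => // w; rewrite /Elt/= => qt.
  by move: (lt_le_trans qt t0); rewrite ltNge; case/andP: (q01 w) => ->.
(* Elt t is the increasing union of the Ele (t - 1 / n.+1), each of which is
   contained in Ele r for some rational r of [0, t[ *)
pose F n := p @^-1` A `&` Ele (t - n.+1%:R^-1)%R.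
have mF n : measurable (F n) by exact: measurableI.
have FE : p @^-1` A `&` Elt t = \bigcup_n F n.
  rewrite /F -setI_bigcupr; congr (_ `&` _); apply/seteqP; split => w.
    rewrite /Elt/= => qt.
    have /ltr_add_invr[k qk] := qt; exists k => //.
    by rewrite /Ele/= lerBrDr ltW.
  move=> [k _]; rewrite /Ele/Elt/= => /le_lt_trans; apply.
  by rewrite ltrBlDr ltrDl invr_gt0.
have ndF : nondecreasing_seq F.
  move=> m n mn; apply/subsetPset => w [Aw Ew]; split => //.
  apply: le_trans Ew _; rewrite lerD2l lerN2 lef_pV2 ?posrE//.
  by rewrite ler_nat.
have Fcvg := @nondecreasing_cvg_mu _ _ _ gamma F mF
  (bigcupT_measurable F mF) ndF.
rewrite FE -(cvg_lim _ Fcvg)//; apply: lime_le; first exact/cvgP/Fcvg.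
apply: nearW => n /=.
have /rat_in_itvoo[r] : (Num.max 0 (t - n.+1%:R^-1) < t)%R.
  by rewrite gt_max t0 /= ltrBlDr ltrDl invr_gt0.
rewrite in_itv/= gt_max -andbA => /and3P[r0 tr rt].
apply: (@le_trans _ _ (gamma (p @^-1` A `&` Ele (ratr r)))).
  apply: le_measure; rewrite ?inE//; first exact: measurableI.
  by apply: setIS => w; rewrite /Ele/= => /le_trans; apply; exact: ltW.
rewrite -(M_D (mEle _) mA); apply: le_measure; rewrite ?inE.
- by apply: measurableI; [exact: mcyl|exact: mD].
- by apply: measurableI; [exact: mcyl|exact: bigcupT_measurable].
- have [|k kE] := @idxE t r; first by rewrite (ltW r0) rt.
  by apply: setIS => z Dz; exists k => //; rewrite kE.
Qed.

(** The laws of (f, h) and of (p, q) agree on products of A with half-lines, by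
the choice of h, hence on all products. *)
Lemma transfer : exists h : X * measurableTypeR R -> R,
  measurable_fun setT h /\
  forall A B, measurable A -> measurable B ->
    M [set z | A (f z.1) /\ B (h z)] = gamma [set w | A (p w) /\ B (q w)].
Proof.
exists h; split => // A B mA mB.
have mA' := mcyl mA.
have mpA : measurable (p @^-1` A) by exact: measurable_funPTI.
unshelve epose (m1 := pushforward (mrestr M mA') h :
  {measure set R -> \bar R}); first exact: mh.
unshelve epose (m2 := pushforward (mrestr gamma mpA) q :
  {measure set R -> \bar R}); first exact: measurable_funPT.
suff : m1 B = m2 B.
  by rewrite /= /pushforward /mrestr/= ![_ `&` cyl _]setIC
    ![_ `&` p @^-1` A]setIC.
apply: (measure_unique (@RGenInftyO.G R) (fun n => `]-oo, n%:R[%classic)) => //.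
- exact: RGenInftyO.measurableE.
- move=> _ _ [s ->] [t ->]; exists (Num.min s t); apply/seteqP; split => x /=.
    by rewrite !in_itv/= lt_min => -[-> ->].
  by rewrite !in_itv/= lt_min => /andP[].
- by move=> n; exists n%:R.
- apply/seteqP; split => // x _; exists (Num.truncn `|x|).+1 => //=.
  by rewrite in_itv/= (le_lt_trans (ler_norm x))// truncnS_gt.
- move=> _ [t ->]; rewrite /= /pushforward /mrestr/=.
  rewrite setIC [RHS](_ : _ = gamma (p @^-1` A `&` Elt t)); last first.
    by congr (gamma _); rewrite setIC; congr (_ `&` _);
      apply/seteqP; split => w; rewrite /= in_itv.
  rewrite -M_h_lt//; congr (M _); congr (_ `&` _); apply/seteqP; split => w;
    by rewrite /= in_itv.
- move=> n; rewrite /= /pushforward /mrestr/= ltey_eq; apply/orP; left.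
  apply: (fin_num_measure M); apply: measurableI => //.
  rewrite -[X in measurable X]setTI; exact: mh.
Qed.

End transfer.

(** * Coding sequences of digits by real numbers *)

Section cantor_coding.
Context (R : realType).

(** The n-th partial sum of the ternary expansion with digits 2 * c k. The
digit 1 does not occur, which makes the expansion unique. *)
Fixpoint cantor_sum (n : nat) (c : nat -> bool) : R :=
  if n is m.+1 then (c 0)%:R * (2 / 3) + cantor_sum m (c \o S) / 3 else 0.

Definition cantor_real (c : nat -> bool) : R := limn (cantor_sum ^~ c).

(** Deletes the first ternary digit of the expansion above. *)
Definition cantor_shift (x : R) : R :=
  if x <= 1 / 2 then 3 * x else 3 * x - 2.

Definition cantor_digit (k : nat) : set R :=
  [set x | 1 / 2 < iter k cantor_shift x].

Lemma cantor_sum01 n c : 0 <= cantor_sum n c <= 1.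
Proof.
elim: n c => [|n IHn] c /=; first by rewrite lexx ler01.
by have /andP[] := IHn (c \o S); case: (c 0) => /=; lra.
Qed.

Lemma cantor_sum_nd c : nondecreasing_seq (cantor_sum ^~ c).
Proof.
apply/nondecreasing_seqP => n; elim: n c => [|n IHn] c.
  by have /andP[] := cantor_sum01 1 c.
by rewrite [leLHS]/= [leRHS]/= lerD2l ler_pM2r ?invr_gt0//; exact: IHn.
Qed.

Lemma cantor_sum_cvg c : cantor_sum n c @[n --> \oo] --> cantor_real c.
Proof.
apply: nondecreasing_is_cvgn; first exact: cantor_sum_nd.
by exists 1 => _ [n _ <-]; have /andP[] := cantor_sum01 n c.
Qed.

Lemma cantor_real01 c : 0 <= cantor_real c <= 1.
Proof.
apply/andP; split.
  apply: limr_ge; first exact/cvgP/cantor_sum_cvg.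
  by apply: nearW => n; have /andP[] := cantor_sum01 n c.
apply: limr_le; first exact/cvgP/cantor_sum_cvg.
by apply: nearW => n; have /andP[] := cantor_sum01 n c.
Qed.

Lemma cantor_real_rec c :
  cantor_real c = (c 0)%:R * (2 / 3) + cantor_real (c \o S) / 3.
Proof.
have /cvg_lim <- // : cantor_sum n c @[n --> \oo] -->
    (c 0)%:R * (2 / 3) + cantor_real (c \o S) / 3.
rewrite -cvg_shiftS /=; apply: cvgD; first exact: cvg_cst.
by apply: cvgMl; exact: cantor_sum_cvg.
Qed.

Lemma cantor_real_gt_half c : (1 / 2 < cantor_real c) = c 0.
Proof.
rewrite cantor_real_rec; have /andP[] := cantor_real01 (c \o S).
by case: (c 0) => /= ? ?; [apply/idP|apply/negP/negP; rewrite -leNgt]; lra.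
Qed.

Lemma cantor_shift_real c : cantor_shift (cantor_real c) = cantor_real (c \o S).
Proof.
rewrite /cantor_shift leNgt cantor_real_gt_half cantor_real_rec.
by case: (c 0) => /=; lra.
Qed.

(** [cantor_digit k] reads off the k-th digit: the first digit is 1 exactly when
the number exceeds 1 / 2, and k shifts bring the k-th digit to the front. *)
Lemma cantor_digitP k c : cantor_digit k (cantor_real c) <-> c k.
Proof.
rewrite /cantor_digit /=.
suff -> : iter k cantor_shift (cantor_real c) =
    cantor_real (fun n => c (k + n)%N).
  by rewrite cantor_real_gt_half addn0.
elim: k => [|k IHk] //=; rewrite IHk cantor_shift_real; congr cantor_real.
by apply/funext => n /=; rewrite addnS addSn.
Qed.

Lemma measurable_cantor_shift : measurable_fun setT cantor_shift.
Proof.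
apply: measurable_fun_ifT => //=.
- exact: measurable_fun_ler.
- by apply: measurable_funB => //; exact: mulrl_measurable.
Qed.

Lemma measurable_cantor_digit k : measurable (cantor_digit k).
Proof.
have miter : measurable_fun setT (iter k cantor_shift).
  elim: k => [|k IHk]; first exact: measurable_id.
  exact: (measurableT_comp measurable_cantor_shift IHk).
rewrite (_ : cantor_digit k = [set: R] `&`
    (fun x => 1 / 2 < iter k cantor_shift x) @^-1` [set true]).
  exact: measurable_fun_ltr.
by rewrite setTI.
Qed.

Lemma measurable_cantor_real d (T : measurableType d) (c : T -> nat -> bool) :
  (forall k, measurable_fun setT (c ^~ k)) ->
  measurable_fun setT (fun x => cantor_real (c x)).
Proof.
move=> mc; apply: (measurable_fun_cvg (h := fun n x => cantor_sum n (c x))).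
  move=> n; elim: n c mc => [|n IHn] c mc /=; first exact: measurable_cst.
  apply: measurable_funD; apply: measurable_funM => //; last first.
    by apply: (IHn (fun x => c x \o S)) => k; exact: mc.
  rewrite (_ : (fun x => _) = fun x => if c x 0 then 1 else 0 : R).
    exact: measurable_fun_ifT.
  by apply/funext => x; case: (c x 0).
by move=> x _; exact: cantor_sum_cvg.
Qed.

End cantor_coding.

(** * Polish spaces as Borel retracts of the real line *)

Section polish_spaces.
Context (R : realType) (T : ptopologicalType).

Lemma open_metric_ball (dist : T -> T -> R) x e :
  is_metric dist -> metrizes dist -> open [set y | dist x y < e].
Proof.
move=> [_ _ _ tri] met; rewrite openE => y /= xye; apply/met.
exists (e - dist x y); first by rewrite subr_gt0.
by move=> z /= yz; apply: le_lt_trans (tri x y z) _; rewrite -ltrBrDl.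
Qed.

Lemma polish_dense_seq : polish R T ->
  exists (dist : T -> T -> R) (s : nat -> T),
  [/\ is_metric dist, metrizes dist, complete_metric dist &
      forall x e, 0 < e -> exists n, dist (s n) x < e].
Proof.
move=> [[D /countable_injP[i inji] dD] [dist [distP met cmp]]].
exists dist, (fun n => xget point [set x | D x /\ i x = n]); split => // x e e0.
have [_ dist0 distC _] := distP.
have [|z [xz Dz]] := dD _ _ (open_metric_ball x e distP met).
  by exists x => /=; rewrite (dist0 x x).2.
exists (i z); case: xgetP => [y _ [Dy iyz]|/(_ z)]; last by case.
by rewrite (inji y z) ?inE// distC.
Qed.

Lemma polish_countable_base : polish R T -> exists B : nat -> set T,
  (forall n, open (B n)) /\
  forall x U, nbhs x U -> exists n, B n x /\ B n `<=` U.
Proof.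
move=> /polish_dense_seq[dist [s [distP met _ sD]]].
have [_ _ distC tri] := distP.
have [code codeK] : exists code : nat -> nat * nat,
    forall a, exists n, code n = a.
  exists (fun n => odflt (0, 0)%N (unpickle n)) => a.
  by exists (pickle a); rewrite pickleK.
exists (fun n => [set y | dist (s (code n).1) y < (code n).2.+1%:R^-1]); split.
  by move=> n; exact: open_metric_ball.
move=> x U /met[e e0 eU].
have [|k] := @ltr_add_invr R 0 (e / 2); first by lra.
rewrite add0r => ke; have [i ix] := sD x k.+1%:R^-1 ltac:(by rewrite invr_gt0).
have [n nik] := codeK (i, k); exists n; rewrite nik /=; split => // y /= iy.
apply: eU => /=; apply: le_lt_trans (tri x (s i) y) _; rewrite distC.
by move: ke ix iy; set r := _^-1; lra.
Qed.

Lemma measurable_Prop d (X : measurableType d) (Q : Prop) :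
  measurable [set x : X | Q].
Proof.
have [q|nq] := pselect Q.
  by rewrite (_ : [set x | _] = setT)//; apply/seteqP; split.
by rewrite (_ : [set x | _] = set0)//; apply/seteqP; split.
Qed.

Lemma measurable_imply d (X : measurableType d) (A : set X) (Q : Prop) :
  measurable A -> measurable [set x | A x -> Q].
Proof.
move=> mA; rewrite (_ : [set x | _] = ~` A `|` [set x | Q]).
  by apply: measurableU; [exact: measurableC|exact: measurable_Prop].
apply/seteqP; split => x /=; last by case=> // nAx Ax; case: (nAx Ax).
by move=> AQ; have [Ax|nAx] := pselect (A x); [right; exact: AQ|left].
Qed.

(** phi y codes the balls of radius 1 / n.+1 around the points s i that contain
y. The decoding rho is a limit of centers wherever the digits make these centers
a Cauchy family with a uniform rate, and constant elsewhere; the uniform rate is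
what makes rho Borel. *)
Lemma polish_real_coding : polish R T ->
  exists (phi : borel T -> R) (rho : R -> borel T),
  [/\ measurable_fun setT phi, measurable_fun setT rho,
      forall y, 0 <= phi y <= 1 & cancel phi rho].
Proof.
move=> /polish_dense_seq[dist [s [distP met cmp sD]]].
have [dist_ge0 dist0 distC tri] := distP.
have [code [code' codeK]] : exists (code : nat -> nat * nat)
    (code' : nat -> nat -> nat), forall n i, code (code' n i) = (n, i).
  exists (fun n => odflt (0, 0)%N (unpickle n)), (fun n i => pickle (n, i)).
  by move=> n i; rewrite pickleK.
pose r n : R := n.+1%:R^-1.
have r_gt0 n : 0 < r n by rewrite invr_gt0.
have r_small e : 0 < e ->
    exists2 N, r N < e & forall n, (N <= n)%N -> r n <= r N.
  move=> e0; have [k] := @ltr_add_invr R 0 e e0; rewrite add0r => ke.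
  by exists k => // n kn; rewrite /r lef_pV2 ?posrE// ler_nat.
pose c (y : borel T) k := dist (s (code k).2) y < r (code k).1.
have mc k : measurable_fun setT (c ^~ k).
  apply: (@measurable_fun_bool _ _ _ _ true); rewrite setTI.
  by apply: sub_sigma_algebra; exact: open_metric_ball.
pose B n i : set R := @cantor_digit R (code' n i).
have mB n i : measurable (B n i) by exact: measurable_cantor_digit.
have BP n i y : B n i (@cantor_real R (c y)) <-> dist (s i) y < r n.
  by rewrite /B cantor_digitP /c codeK.
(* The reals whose digits select, at every radius, at least one ball, and any
   two selected balls meet as far as their radii can tell. Asking this of all
   selected balls avoids choosing one of them measurably. *)
pose G : set R := (\bigcap_n \bigcup_i B n i) `&` \bigcap_n \bigcap_m \bigcap_i
  \bigcap_j [set x | (B n i `&` B m j) x -> dist (s i) (s j) < r n + r m].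
have mG : measurable G.
  apply: measurableI.
    by apply: bigcapT_measurable => n; exact: bigcupT_measurable.
  do 4 (apply: bigcapT_measurable => ?).
  by apply: measurable_imply; exact: measurableI.
have Gcauchy x n m i j :
    G x -> B n i x -> B m j x -> dist (s i) (s j) < r n + r m.
  by move=> [_ Gx] nx mx; exact: (Gx n I m I i I j I).
have /choice[rho rhoP] : forall x, exists l : borel T,
    (G x -> forall n i, B n i x -> dist (s i) l <= r n) /\ (~ G x -> l = point).
  move=> x; have [Gx|nGx] := pselect (G x); last by exists point.
  have /choice[i iP] n : exists i, B n i x by have [i _] := Gx.1 n I; exists i.
  have [|l ul] := cmp (fun n => s (i n)).
    move=> e e0; have [|N Ne NP] := r_small (e / 2); first by lra.
    exists N => m n Nm Nn.
    apply: lt_le_trans (Gcauchy _ _ _ _ _ Gx (iP m) (iP n)) _.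
    by move: (NP _ Nm) (NP _ Nn); lra.
  exists l; split => // _ n j nj; apply/ler_addgt0Pr => e e0.
  have [|N Ne NP] := r_small (e / 2); first by lra.
  have /ul[K _ KP] : nbhs l [set z | dist l z < e / 2].
    by apply/met; exists (e / 2) => //; lra.
  pose k := maxn K N.
  have lk : dist l (s (i k)) < e / 2 by apply: KP; exact: leq_maxl.
  have Nk : (N <= k)%N by exact: leq_maxr.
  have := tri (s j) (s (i k)) l; rewrite (distC (s (i k)) l).
  have := Gcauchy _ _ _ _ _ Gx nj (iP k); have := NP _ Nk; lra.
exists (fun y => @cantor_real R (c y)), rho; split.
- exact: measurable_cantor_real.
- apply: (@measurability _ _ R (borel T) setT rho (@open T)) => //.
  move=> _ [U oU <-]; rewrite setTI.
  (* On G, rho x lies in U exactly when some selected ball has its closed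
     version inside U. *)
  pose V := \bigcup_n \bigcup_i
    (B n i `&` [set x | [set l | dist (s i) l <= r n] `<=` U]).
  have mV : measurable V.
    apply: bigcupT_measurable => n; apply: bigcupT_measurable => i.
    by apply: measurableI => //; exact: measurable_Prop.
  rewrite (_ : rho @^-1` U =
      (G `&` V) `|` (~` G `&` [set x | U point])); last first.
    apply/seteqP; split => x /=.
      move=> Ux; have [Gx|nGx] := pselect (G x); [left|right]; split => //.
        have [e e0 eU] := (met (rho x) U).1 (open_nbhs_nbhs (conj oU Ux)).
        have [|n ne _] := r_small (e / 2); first by lra.
        have [i _ ni] := Gx.1 n I; exists n => //; exists i => //; split => //.
        move=> l /= il; apply: eU => /=.
        have := (rhoP x).1 Gx n i ni.
        by have := tri (rho x) (s i) l; rewrite (distC (rho x) (s i)); lra.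
      by move: Ux; rewrite (rhoP x).2.
    move=> [[Gx [n _ [i _ [ni]]]]|[nGx pU]].
      by apply; exact: (rhoP x).1.
    by rewrite (rhoP x).2.
  apply: measurableU; apply: measurableI => //; first exact: measurableC.
  exact: measurable_Prop.
- by move=> y; exact: cantor_real01.
- move=> y; set x := @cantor_real R (c y).
  have Gx : G x.
    split.
      move=> n _; have [i iy] := sD y (r n) (r_gt0 n).
      by exists i => //; apply/BP.
    move=> n _ m _ i _ j _ [/BP iy /BP jy].
    by have := tri (s i) y (s j); rewrite (distC y); lra.
  apply/dist0/eqP; rewrite eq_le dist_ge0 andbT; apply/ler_addgt0Pr => e e0.
  have [|N Ne _] := r_small (e / 2); first by lra.
  have [i iy] := sD y (r N) (r_gt0 N).
  have := (rhoP x).1 Gx N i ((BP _ _ _).2 iy).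
  have := tri (rho x) (s i) y; rewrite (distC (rho x) (s i)); lra.
Qed.

End polish_spaces.

(** * The Borel sets of a square *)

Section borel_square.
Context (R : realType) (T : ptopologicalType).

Lemma continuous_square_borel (k : T * T -> T) :
  continuous k -> measurable_fun setT (k : borel (T * T)%type -> borel T).
Proof.
move=> /continuousP ck.
apply: (@measurability _ _ (borel (T * T)%type) (borel T) setT k
  (@open T)) => //.
by move=> _ [U oU <-]; rewrite setTI; apply: sub_sigma_algebra; exact: ck.
Qed.

Lemma measurable_fst_borel :
  measurable_fun setT (fst : borel (T * T)%type -> borel T).
Proof. by apply: continuous_square_borel => x; exact: cvg_fst. Qed.

Lemma measurable_snd_borel :
  measurable_fun setT (snd : borel (T * T)%type -> borel T).
Proof. by apply: continuous_square_borel => x; exact: cvg_snd. Qed.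

Lemma lower_semicontinuous_borel (c : T * T -> R) :
  lower_semicontinuous (fun x => (c x)%:E) ->
  measurable_fun setT (fun x : borel (T * T)%type => (c x)%:E).
Proof.
move=> lsc; apply: (measurability _ (ErealGenOInfty.measurableE R)).
move=> /= _ [_ [a ->]] <-; rewrite setTI; apply: sub_sigma_algebra.
by rewrite preimage_itvoy; move/lower_semicontinuousP : lsc; exact.
Qed.

Hypothesis polT : polish R T.

(** An open set of T x T is the union of the products of two members of a
countable base that it contains; for an uncountable union of rectangles the
preimage could fail to be measurable. *)
Lemma measurable_pair_borel d (Z : measurableType d) (k l : Z -> borel T) :
  measurable_fun setT k -> measurable_fun setT l ->
  measurable_fun setT (fun z => (k z, l z) : borel (T * T)%type).
Proof.
move=> mk ml.
have [B [oB Bbase]] := polish_countable_base polT.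
apply: (@measurability _ _ Z (borel (T * T)%type) setT _
  (@open (T * T)%type)) => //.
move=> _ [U oU <-]; rewrite setTI.
have mB n : measurable (B n : set (borel T)).
  by apply: sub_sigma_algebra; exact: oB.
rewrite (_ : _ @^-1` U = \bigcup_n \bigcup_m
    (k @^-1` B n `&` l @^-1` B m `&` [set z | B n `*` B m `<=` U])).
  apply: bigcupT_measurable => n; apply: bigcupT_measurable => m.
  apply: measurableI; last exact: measurable_Prop.
  apply: measurableI; rewrite -[X in measurable X]setTI.
    exact: mk.
  exact: ml.
apply/seteqP; split => z /=.
  move=> Uz; have nU : nbhs (k z, l z) U by exact: open_nbhs_nbhs.
  have [[U1 U2] /= [kU1 lU2] U12] := nU.
  have [n [nk nU1]] := Bbase _ _ kU1; have [m [ml' mU2]] := Bbase _ _ lU2.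
  exists n => //; exists m => //; split => // -[y1 y2] /= [/nU1 ? /mU2 ?].
  exact: U12.
by move=> [n _ [m _ [[kz lz] BU]]]; exact: BU.
Qed.

(** The previous lemma, for the two projections of the product of two copies of
the Borel sigma-algebra, says that Borel sets of T x T belong to the
sigma-algebra generated by rectangles. *)
Lemma eq_measure_borel_square
    (m1 m2 : probability (borel (T * T)%type) R) :
  (forall A B : set (borel T), measurable A -> measurable B ->
    m1 [set z | A z.1 /\ B z.2] = m2 [set z | A z.1 /\ B z.2]) ->
  forall E, measurable E -> m1 E = m2 E.
Proof.
move=> m12 E mE.
pose G := [set A `*` B | A in (measurable : set (set (borel T))) &
                         B in (measurable : set (set (borel T)))].
have GE : <<s G >> E.
  rewrite -[<<s G >>]measurable_prod_measurableType.
  have := @measurable_pair_borel _ (borel T * borel T)%type fst snd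
    measurable_fst measurable_snd measurableT E mE.
  by rewrite setTI (_ : _ @^-1` E = E)//; apply/seteqP; split => -[].
apply: (@g_sigma_algebra_measure_unique _ _ (borel (T * T)%type) G
  _ (fun=> setT)) => //.
- move=> _ [A mA [B mB <-]].
  rewrite (_ : A `*` B = fst @^-1` A `&` snd @^-1` B)//.
  apply: measurableI; rewrite -[X in measurable X]setTI.
    exact: measurable_fst_borel.
  exact: measurable_snd_borel.
- by move=> _; exists setT => //; exists setT => //; rewrite setXTT.
- by rewrite bigcup_const.
- move=> _ _ [A mA [B mB <-]] [A' mA' [B' mB' <-]].
  exists (A `&` A'); first exact: measurableI.
  exists (B `&` B'); first exact: measurableI.
  by rewrite setXI.
- by move=> _ [A mA [B mB <-]]; exact: m12.
- by move=> _ /=; rewrite probability_setT ltry.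
Qed.

End borel_square.

(** * Transport costs along a map *)

Section pushing_couplings.
Context (R : realType) (X Y : ptopologicalType).
Hypothesis polY : polish R Y.
Variable f : {mfun borel X >-> borel Y}.

Lemma measurable_prod_map :
  measurable_fun setT (prod_map f : borel (X * X)%type -> borel (Y * Y)%type).
Proof.
have mf1 : measurable_fun setT (f \o (fst : borel (X * X)%type -> borel X)).
  exact: measurableT_comp (measurable_funPT f) (@measurable_fst_borel X).
have mf2 : measurable_fun setT (f \o (snd : borel (X * X)%type -> borel X)).
  exact: measurableT_comp (measurable_funPT f) (@measurable_snd_borel X).
exact: (measurable_pair_borel polY mf1 mf2).
Qed.

Lemma OT_le_couplings (P Q : probability (borel X) R)
    (P' Q' : probability (borel Y) R) (c : X * X -> R) (e : Y * Y -> R) :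
  (forall gamma, coupling P Q gamma -> exists2 gamma', coupling P' Q' gamma' &
    (\int[gamma']_(z in [set: borel (Y * Y)%type]) (e z)%:E =
     \int[gamma]_(z in [set: borel (X * X)%type]) (c z)%:E)%E) ->
  (OT e P' Q' <= OT c P Q)%E.
Proof.
move=> h; apply: ereal_inf_le_tmp => _ [gamma /h[gamma' G' <-] <-].
by exists gamma'.
Qed.

(** P' and Q' need only agree with the pushforwards on Borel sets, because the
values of a measure elsewhere are arbitrary. *)
Lemma OT_pushforward_le (e : Y * Y -> R) (P Q : probability (borel X) R)
    (P' Q' : probability (borel Y) R) :
  measurable_fun setT (fun z : borel (Y * Y)%type => (e z)%:E) ->
  (forall z, 0 <= e z) ->
  (forall A : set (borel Y), measurable A -> P' A = distribution P f A) ->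
  (forall A : set (borel Y), measurable A -> Q' A = distribution Q f A) ->
  (OT e P' Q' <= OT (e \o prod_map f) P Q)%E.
Proof.
move=> me e0 P'E Q'E; apply: OT_le_couplings => gamma gammaP.
pose ffM := isMeasurableFun.Build _ _ _ _ _ measurable_prod_map.
pose ff : {mfun borel (X * X)%type >-> borel (Y * Y)%type} :=
  HB.pack (prod_map f : borel (X * X)%type -> borel (Y * Y)%type) ffM.
exists (distribution gamma ff).
  move=> A mA; have [fA1 fA2] := gammaP _ (measurable_funPTI f mA).
  by rewrite P'E// Q'E//.
by rewrite ge0_integral_distribution// => z; rewrite lee_fin.
Qed.

End pushing_couplings.

Section lifting_couplings.
Context (R : realType) (X Y : ptopologicalType).
Hypotheses (polX : polish R X) (polY : polish R Y).
Variables (f : {mfun borel X >-> borel Y}) (g : {mfun borel Y >-> borel X}).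
Hypothesis gK : cancel g f.

(** Let (x, u) have law P x uniform. A coupling gamma of f_# P and Q is lifted
to the law of (x, g (rho (h (x, u)))), where h transfers the law of
(fst, phi \o snd) under gamma. As f \o g = id and rho \o phi = id, the map
f x f sends this law back to gamma. *)
Lemma OT_lift_le (e : Y * Y -> R) (P : probability (borel X) R)
    (Q : probability (borel Y) R) :
  measurable_fun setT (fun z : borel (Y * Y)%type => (e z)%:E) ->
  (forall z, 0 <= e z) ->
  (OT (e \o prod_map f) P (distribution Q g) <= OT e (distribution P f) Q)%E.
Proof.
move=> me e0; apply: OT_le_couplings => gamma gammaP.
have [phi [rho [mphi mrho phi01 phiK]]] := polish_real_coding polY.
pose W := borel (Y * Y)%type.
pose pM := isMeasurableFun.Build _ _ _ _ _ (@measurable_fst_borel Y).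
pose p : {mfun W >-> borel Y} := HB.pack (fst : W -> borel Y) pM.
have mq : measurable_fun setT (phi \o (snd : W -> borel Y)).
  exact: measurableT_comp mphi (@measurable_snd_borel Y).
pose qM := isMeasurableFun.Build _ _ _ _ _ mq.
pose q : {mfun W >-> R} := HB.pack (phi \o (snd : W -> borel Y)) qM.
have [|//|h [mh hE]] := @transfer _ _ _ _ _ _ _ P gamma f p q.
  by move=> A mA; have [] := gammaP A mA.
  by move=> w; exact: phi01.
pose Z := (borel X * measurableTypeR R)%type.
pose k (z : Z) : borel X := g (rho (h z)).
have mk : measurable_fun setT k.
  apply: (measurableT_comp (measurable_funPT g)).
  exact: (measurableT_comp mrho mh).
have mH : measurable_fun setT (fun z : Z => (z.1, k z) : borel (X * X)%type).
  exact: (@measurable_pair_borel _ _ polX _ Z fst k measurable_fst mk).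
pose HM := isMeasurableFun.Build _ _ _ _ _ mH.
pose H : {mfun Z >-> borel (X * X)%type} :=
  HB.pack (fun z : Z => (z.1, k z) : borel (X * X)%type) HM.
pose ffM := isMeasurableFun.Build _ _ _ _ _ (measurable_prod_map polY f).
pose ff : {mfun borel (X * X)%type >-> borel (Y * Y)%type} :=
  HB.pack (prod_map f : borel (X * X)%type -> borel (Y * Y)%type) ffM.
pose gamma' := distribution (with_uniform P) H.
exists gamma'.
  move=> A mA; split.
    rewrite /gamma' /distribution /pushforward /=.
    rewrite (_ : _ @^-1` _ = A `*` setT); last first.
      by apply/seteqP; split => z //= [].
    rewrite [LHS]product_measure1E//.
    by rewrite [X in (_ * X)%E](probability_setT (@unif01 R)) mule1.
  have mrgA : measurable (rho @^-1` (g @^-1` A)).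
    by rewrite -[X in measurable X]setTI; apply: mrho => //;
      exact: measurable_funPTI.
  have := hE setT _ measurableT mrgA.
  rewrite (_ : [set w | _ /\ _] = [set z : W | (g @^-1` A) z.2]); last first.
    by apply/seteqP; split => w /=; rewrite phiK// => -[].
  have [_ ->] := gammaP _ (measurable_funPTI g mA) => QgA.
  apply: etrans QgA.
  by congr (with_uniform P _); apply/seteqP; split => z //= [].
transitivity (\int[distribution gamma' ff]_z (e z)%:E)%E.
  by rewrite [RHS]ge0_integral_distribution// => z; rewrite lee_fin.
apply: eq_measure_integral => E mE _.
apply: (eq_measure_borel_square polY) => // A B mA mB.
have mrB : measurable (rho @^-1` B).
  by rewrite -[X in measurable X]setTI; exact: mrho.
have := hE A _ mA mrB.
rewrite (_ : [set w | _ /\ _] = [set z : W | A z.1 /\ B z.2]); last first.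
  by apply/seteqP; split => w /=; rewrite phiK.
move=> <-; congr (with_uniform P _); apply/seteqP; split => z /=.
  by rewrite /k gK.
by rewrite /k gK.
Qed.

End lifting_couplings.

(** * Images of ambiguity sets *)

Theorem theorem4 (R : realType) (X Y : ptopologicalType)
    (polishX : polish R X) (polishY : polish R Y)
    (P : probability (borel X) R) (eps : R) (eps_ge0 : 0 <= eps)
    (f : {mfun borel X >-> borel Y})
    (d : Y * Y -> R) (cost_d : transportation_cost d) :
  pushforward_set f (OT_ball (d \o prod_map f) eps P)
    `<=` OT_ball d eps (distribution P f)
  /\
  forall (c : X * X -> R) (cost_c : transportation_cost c),
  [/\ forall g : {mfun borel Y >-> borel X}, cancel f g -> cancel g f ->
        pushforward_set f (OT_ball c eps P)
          = OT_ball (c \o prod_map g) eps (distribution P f),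
      forall g : {mfun borel Y >-> borel X}, cancel f g ->
        pushforward_set f (OT_ball c eps P)
          = pushforward_set (f \o g)
              (OT_ball (c \o prod_map g) eps (distribution P f))
        /\ pushforward_set (f \o g)
             (OT_ball (c \o prod_map g) eps (distribution P f))
           `<=` OT_ball (c \o prod_map g) eps (distribution P f) &
      forall g : {mfun borel Y >-> borel X}, cancel g f ->
        pushforward_set f (OT_ball (c \o prod_map g \o prod_map f) eps P)
          = OT_ball (c \o prod_map g) eps (distribution P f)
        /\ OT_ball (c \o prod_map g) eps (distribution P f)
           `<=` pushforward_set f (OT_ball c eps (distribution P (g \o f)))].
Proof.
have push_ball (e : Y * Y -> R) :
    measurable_fun setT (fun z : borel (Y * Y)%type => (e z)%:E) ->
    (forall z, 0 <= e z) ->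
    pushforward_set f (OT_ball (e \o prod_map f) eps P)
      `<=` OT_ball e eps (distribution P f).
  move=> me e0 Q' [Q PQ Q'E]; apply: le_trans PQ.
  exact: (OT_pushforward_le polishY me e0).
split.
  case: cost_d => d0 lsc; apply: push_ball => //.
  exact: lower_semicontinuous_borel.
move=> c [c0 /lower_semicontinuous_borel mc].
have mcg (g : {mfun borel Y >-> borel X}) :
    measurable_fun setT
      (fun z : borel (Y * Y)%type => ((c \o prod_map g) z)%:E).
  exact: measurableT_comp mc (measurable_prod_map polishX g).
have pull_ball (g : {mfun borel Y >-> borel X}) 
    (P' : probability (borel X) R) Q :
    (forall A : set (borel X), measurable A ->
      P' A = distribution (distribution P f) g A) ->
    OT_ball (c \o prod_map g) eps (distribution P f) Q ->
    OT_ball c eps P' (distribution Q g).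
  move=> P'E QB; apply: le_trans QB.
  exact: (OT_pushforward_le polishX mc c0).
have cgf (g : {mfun borel Y >-> borel X}) : cancel f g ->
    (c \o prod_map g) \o prod_map f = c.
  by move=> fK; apply/funext => -[x1 x2]; rewrite /prod_map /= !fK.
have Pgf (g : {mfun borel Y >-> borel X}) : cancel f g ->
    forall A : set (borel X), measurable A ->
      P A = distribution (distribution P f) g A.
  move=> fK A _; rewrite /distribution /pushforward /=; congr (P _).
  by apply/seteqP; split => x /=; rewrite fK.
have push_cg (g : {mfun borel Y >-> borel X}) : cancel f g ->
    pushforward_set f (OT_ball c eps P)
      `<=` OT_ball (c \o prod_map g) eps (distribution P f).
  move=> fK; rewrite -[in X in X `<=` _](cgf g fK).
  by apply: push_ball (mcg g) _ => z; exact: c0.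
split.
- move=> g fK gK; apply/seteqP; split; first exact: push_cg.
  move=> Q QB; exists (distribution Q g); first exact: pull_ball (Pgf g fK) QB.
  move=> A _; rewrite /distribution /pushforward /=; congr (Q _).
  by apply/seteqP; split => y /=; rewrite gK.
- move=> g fK.
  have fg_eq : pushforward_set f (OT_ball c eps P) = pushforward_set (f \o g)
      (OT_ball (c \o prod_map g) eps (distribution P f)).
    apply/seteqP; split => Q'.
      move=> [Q QB Q'E]; exists (distribution Q f).
        by apply: push_cg => //; exists Q.
      move=> A mA; rewrite Q'E// /distribution /pushforward /=; congr (Q _).
      by apply/seteqP; split => x /=; rewrite fK.
    move=> [Q QB Q'E]; exists (distribution Q g) => //.
    exact: pull_ball (Pgf g fK) QB.
  by split => //; rewrite -fg_eq; exact: push_cg.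
- move=> g gK; split; last first.
    move=> Q QB; exists (distribution Q g); first exact: pull_ball QB.
    move=> A _; rewrite /distribution /pushforward /=; congr (Q _).
    by apply/seteqP; split => y /=; rewrite gK.
  apply/seteqP; split; first by apply: push_ball (mcg g) _ => z; exact: c0.
  move=> Q QB; exists (distribution Q g).
    apply: le_trans QB.
    by apply: (OT_lift_le polishX polishY gK) => // z; exact: c0.
  move=> A _; rewrite /distribution /pushforward /=; congr (Q _).
  by apply/seteqP; split => y /=; rewrite gK.
Qed.
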